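(* Let $n$, $m$, and $k$ be positive integers. If $$n < m \le k^n\left(1-\frac{\log_{1.09} n}{\sqrt{2n}}\right),$$ then $D_{\ell}(K_n\Box K_m)\le k$.
   Context: $K_n$ denotes the complete graph on $n$ vertices, and $\Box$ denotes the Cartesian product of graphs: $G\Box H$ has vertex set $V(G)\times V(H)$, with $(g,h)$ adjacent to $(g',h')$ iff either $g=g'$ and $hh'\in E(H)$, or $h=h'$ and $gg'\in E(G)$. A (not necessarily proper) coloring of the vertices of a graph $G$ is distinguishing if the only automorphism of $G$ that preserves the color of every vertex is the identity. A list assignment $L$ on $G$ assigns to each vertex $v$ a set of colors $L(v)$; an $L$-coloring is a coloring in which each vertex $v$ receives a color from $L(v)$. The list-distinguishing number $D_{\ell}(G)$ is the minimum $k$ such that for every list assignment $L$ with $|L(v)|\ge k$ for all vertices $v$, there is a distinguishing $L$-coloring of $G$. $\log_{1.09}$ is the logarithm to base $1.09$. *)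

(* Defs.v *)
From mathcomp Require Import all_boot all_fingroup.
From mathcomp Require Import boolp classical_sets functions cardinality.

Set Implicit Arguments.
Unset Strict Implicit.
Unset Printing Implicit Defensive.

Local Open Scope classical_set_scope.
Local Open Scope card_scope.

Record sgraph := SGraph {
  vertex :> finType;
  adj : rel vertex;
  adj_sym : symmetric adj;
  adj_irr : irreflexive adj
}.

Section Complete.
Variable n : nat.

Definition complete_adj : rel 'I_n := fun i j => i != j.

Fact complete_sym : symmetric complete_adj.
Proof. by move=> i j; rewrite /complete_adj eq_sym. Qed.

Fact complete_irr : irreflexive complete_adj.
Proof. by move=> i; rewrite /complete_adj eqxx. Qed.

Definition complete_graph : sgraph := SGraph complete_sym complete_irr.
End Complete.

Section CartesianProduct.
Variables G H : sgraph.

Definition cart_adj : rel (G * H) := fun x y =>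
  (x.1 == y.1) && adj x.2 y.2 || (x.2 == y.2) && adj x.1 y.1.

Fact cart_sym : symmetric cart_adj.
Proof.
by move=> x y; rewrite /cart_adj !(adj_sym x.1) !(adj_sym x.2) !(eq_sym y.1)
  !(eq_sym y.2).
Qed.

Fact cart_irr : irreflexive cart_adj.
Proof. by move=> x; rewrite /cart_adj !adj_irr !andbF. Qed.

Definition cart_prod : sgraph := SGraph cart_sym cart_irr.
End CartesianProduct.

Definition is_automorphism (G : sgraph) (s : {perm G}) : Prop :=
  forall x y : G, adj (s x) (s y) = adj x y.

Definition distinguishing (G : sgraph) (C : Type) (c : G -> C) : Prop :=
  forall s : {perm G},
    is_automorphism s -> (forall x, c (s x) = c x) -> s = 1%g.

(* Colors range over arbitrary types and lists may be infinite:
   [`I_k #<= L v] says that [L v] has at least [k] elements. *)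
Definition list_distinguishable (G : sgraph) (k : nat) : Prop :=
  forall (C : Type) (L : G -> set C),
    (forall v, `I_k #<= L v) ->
    exists c : G -> C, (forall v, L v (c v)) /\ distinguishing c.

(* Lists of size [#|G|] allow pairwise distinct colors, chosen greedily, so
   the minimum defining [list_dist_number] exists. *)
Lemma list_distinguishable_card (G : sgraph) : list_distinguishable G #|G|.
Proof.
move=> C L sizeL.
have Lne v : exists a, L v a.
  apply: contrapT => Lv0; have : `I_#|G| #<= (set0 : set C).
    apply: card_le_trans (sizeL v) _; apply: subset_card_le => a La.
    by apply: Lv0; exists a.
  move=> /card_le_trans /(_ (card_ge0 C `I_0)).
  by rewrite card_le_II leqNgt (cardD1 v).
have [d Ld] := choice Lne.
suff [c [Lc cinj]] : exists c : G -> C, (forall v, L v (c v)) /\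
    {in enum G &, injective c}.
  exists c; split=> // s _ cs; apply/permP => x; rewrite perm1.
  by apply: cinj; rewrite ?mem_enum.
have : uniq (enum G) /\ size (enum G) <= #|G| by rewrite enum_uniq cardE.
elim: (enum G) => [_|x s IHs [/= /andP[xs us] szs]]; first by exists d; split.
have [c [Lc cinj]] := IHs (conj us (ltnW szs)).
have [a [La ca]] : exists a, L x a /\ forall y, y \in s -> c y <> a.
  apply: contrapT => noa.
  suff : `I_#|G| #<= `I_(size s) by rewrite card_le_II leqNgt szs.
  apply: card_le_trans (card_image_le (fun i => c (nth x s i)) `I_(size s)).
  apply: card_le_trans (sizeL x) _; apply: subset_card_le => a La.
  apply: contrapT => aNim; apply: noa; exists a; split=> // y ys cya.
  by apply: aNim; exists (index y s); rewrite /= ?index_mem// nth_index.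
exists (fun v => if v == x then a else c v); split.
  by move=> v; case: eqP => [->|].
move=> y z; rewrite !inE; case: eqP => [-> _|_ /= ys]; case: eqP => //=.
- by move=> _ zs /esym /(ca _ zs).
- by move=> _ _ /(ca _ ys).
- by move=> _ zs; apply: cinj.
Qed.

Lemma list_distinguishable_ex (G : sgraph) :
  exists k, `[< list_distinguishable G k >].
Proof. by exists #|G|; apply/asboolP; apply: list_distinguishable_card. Qed.

Definition list_dist_number (G : sgraph) : nat :=
  ex_minn (list_distinguishable_ex G).

(* Main.v *)
Require Import Defs.
From mathcomp Require Import boolp classical_sets functions cardinality.
From mathcomp Require Import all_boot all_order all_algebra.
From mathcomp Require Import fingroup perm.
From mathcomp Require Import reals exp zify lra.

Set Implicit Arguments.
Unset Strict Implicit.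
Unset Printing Implicit Defensive.
Import Order.TTheory GRing.Theory Num.Theory.

(* Put [q = trunc_log 2 n]. An automorphism of [K_n box K_m], [n <> m], permutes
   the rows and the columns. After encoding the colors as numbers, the sum of a
   column does not change when its entries are permuted. We color [t = 2 q + 4]
   columns so that their sums are pairwise distinct and no two rows agree on all
   of them. By the Littlewood-Offord inequality, at most [k ^ n / sqrt n]
   colorings of a column have a prescribed sum; as [m + t k ^ n / sqrt n <= k ^ n],
   the other columns can be colored greedily, avoiding these [t] sums and all
   earlier columns. Then a color-preserving automorphism fixes the [t] columns,
   hence all the rows, hence all the columns. *)

(** * Binomial coefficients and antichains *)

(** Induction through [s.+1 * 'C(n.+1, s.+1) = n.+1 * 'C(n, s)], after a reduction by symmetry to
    the upper half [n <= s.*2]. *)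
Lemma sqr_bin_leq n s : 'C(n, s) ^ 2 * n.+1 <= 4 ^ n.
Proof.
have [N] := ubnP n; elim: N => // N IHN in n s *; rewrite ltnS => le_nN.
have [lt_ns|le_sn] := ltnP n s; first by rewrite bin_small.
wlog le_ns2 : s le_sn / n <= s.*2.
  move=> IH; have [/IH|lt_s2n] := leqP n s.*2; first exact.
  by rewrite -bin_sub//; apply: IH; lia.
case: n => [|n] in le_nN le_sn le_ns2 *.
  by rewrite bin0n; case: s {le_sn le_ns2}.
case: s => [//|s] in le_sn le_ns2 *.
have := mul_bin_diag n.+1 s; rewrite [n.+1.-1]/= => EY.
have [lt_ns|ge_ns] := ltnP n.+1 s.+1.*2.
  have := IHN n s ltac:(lia); rewrite (expnS 4).
  move: EY; set X := 'C(n, s); set Y := 'C(_, _); set Q := 4 ^ n => EY leQ.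
  rewrite -(@leq_pmul2l (s.+1 ^ 2)) ?expn_gt0// mulnA -expnMn -EY expnMn.
  rewrite (_ : _ * _ = n.+1 * n.+2 * (X ^ 2 * n.+1)); last by nia.
  rewrite [leqRHS]mulnA; apply: leq_mul => //.
  apply: (@leq_trans (s.+1.*2 * s.+1.*2)); first by apply: leq_mul; lia.
  by rewrite -!muln2 mulnACA mulnn.
(* At the exact middle a single induction step is too lossy. Two steps lead down to ['C(s.*2, s)],
   where [(2s+1)(2s+3) <= (2s+2)^2] suffices. *)
have En : n = s.*2.+1 by lia.
subst n; have EX := mul_bin_down s.*2.+1 s; rewrite [_.+1.-1]/= in EX.
have := IHN s.*2 s ltac:(lia).
have -> : 4 ^ s.*2.+2 = 16 * 4 ^ s.*2 by rewrite !expnS mulnA.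
move: EY EX; set Z := 'C(s.*2, s); set X := 'C(_, s); set Y := 'C(_, _).
set Q := 4 ^ _ => EY EX leQ.
have {}EX : s.*2.+1 * Z = s.+1 * X by rewrite EX; congr (_ * _); lia.
have {}EY : 2 * s.*2.+1 * Z = s.+1 * Y by lia.
rewrite -(@leq_pmul2l (s.+1 ^ 2)) ?expn_gt0// mulnA -expnMn -EY !expnMn.
rewrite (_ : _ * _ = 4 * s.*2.+1 * s.*2.+3 * (Z ^ 2 * s.*2.+1)); last by nia.
apply: leq_trans (leq_mul (leqnn _) leQ) _; rewrite mulnA leq_mul2r.
by apply/orP; right; nia.
Qed.

(* Average the inequality for [X :\ x] over [x \in X]; a set [S] of the family
   survives for the [#|X| - #|S|] points [x] outside it. *)
Lemma antichain_fact_sum (T : finType) (F : {set {set T}}) (X : {set T}) :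
    {in F &, forall S S' : {set T}, S \subset S' -> S = S'} ->
    {in F, forall S : {set T}, S \subset X} ->
  \sum_(S in F) #|S| `! * (#|X| - #|S|)`! <= #|X| `!.
Proof.
have [N] := ubnP #|X|; elim: N => // N IHN in X F *; rewrite ltnS => leXN.
move=> antiF subF.
have [XF|XF] := boolP (X \in F).
  suff -> : F = [set X] by rewrite big_set1 subnn muln1.
  apply/setP => S; rewrite inE; apply/idP/eqP => [SF|->//].
  by apply: antiF => //; apply: subF.
have ltFX S : S \in F -> #|S| < #|X|.
  move=> SF; apply: proper_card; rewrite properEneq subF// andbT.
  by apply: contraNneq XF => <-.
have [X0|[x0 x0X]] := set_0Vmem X.
  rewrite big1 ?leq0n// => S SF; have := ltFX S SF; by rewrite X0 cards0 ltn0.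
have step S : S \in F ->
    #|S| `! * (#|X| - #|S|)`! =
    \sum_(x in X | x \notin S) #|S| `! * (#|X|.-1 - #|S|)`!.
  move=> SF; have ltSX := ltFX S SF.
  rewrite sum_nat_const.
  have -> : #|[pred x in X | x \notin S]| = #|X| - #|S|.
    rewrite -[in RHS](setIidPr (subF S SF)) -cardsD; apply: eq_card => x.
    by rewrite !inE andbC.
  rewrite mulnCA; congr (_ * _); rewrite -subn1 subnAC subn1.
  by case: (#|X| - _) (subn_gt0 #|S| #|X|) => [|p _]; rewrite ?ltSX.
rewrite (eq_bigr _ step) (exchange_big_dep (mem X))//=; last first.
  by move=> S x _ /andP[].
have -> : #|X| `! = \sum_(x in X) (#|X|.-1)`!.
  by rewrite sum_nat_const (cardsD1 x0 X) x0X factS.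
apply: leq_sum => x xX.
have cX : #|X :\ x| = #|X|.-1 by rewrite (cardsD1 x X) xX.
rewrite -cX; apply: leq_trans (IHN (X :\ x) [set S in F | x \notin S] _ _ _).
- rewrite [leqRHS](eq_bigl (fun S => (S \in F) && ((x \in X) && (x \notin S)))) //.
  by move=> S; rewrite inE xX.
- by rewrite cX -ltnS prednK//; apply/card_gt0P; exists x.
- by move=> S S'; rewrite !inE => /andP[SF _] /andP[SF' _]; apply: antiF.
- move=> S; rewrite inE => /andP[SF xS]; rewrite subsetD1 xS andbT.
  exact: subF.
Qed.

(** Sperner's bound: replacing every term of the LYM-type sum by the smallest one bounds [#|F|] by a
    single binomial coefficient. *)
Lemma sqr_card_antichain (T : finType) (F : {set {set T}}) :
    {in F &, forall S S' : {set T}, S \subset S' -> S = S'} ->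
  #|F| ^ 2 * #|T|.+1 <= 4 ^ #|T|.
Proof.
move=> antiF; have := antichain_fact_sum antiF (fun S _ => subsetT S).
rewrite cardsT; set n := #|T| => leF.
have [->|F_neq0] := eqVneq F set0; first by rewrite cards0.
have [S0 S0F] := set0Pn _ F_neq0.
have [S SF minS] := @arg_minnP _ S0 (mem F)
  (fun S => #|S| `! * (n - #|S|)`!) S0F.
have leSn : #|S| <= n by apply: max_card.
suff leFC : #|F| <= 'C(n, #|S|).
  by apply: leq_trans (sqr_bin_leq n #|S|); rewrite leq_mul2r leq_sqr leFC orbT.
rewrite -(@leq_pmul2r (#|S| `! * (n - #|S|)`!)) ?muln_gt0 ?fact_gt0//.
rewrite bin_fact//; apply: leq_trans leF.
by rewrite -sum_nat_const; apply: leq_sum => S' /minS.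
Qed.

(** * Greedy choice of distinct values *)

(** When an index is treated, fewer than [#|J|] values are taken, whereas [h j] has at least [#|J|]
    values on [A j]. *)
Lemma greedy_transversal (J V : finType) (W : eqType) (h : J -> V -> W)
    (A : J -> {set V}) :
    (forall j, {in A j &, injective (h j)}) -> (forall j, #|J| <= #|A j|) ->
  exists2 g : J -> V, forall j, g j \in A j & injective (fun j => h j (g j)).
Proof.
move=> hinj cardA.
suff [g gA ginj] : exists2 g : J -> V, forall j, g j \in A j &
    {in enum J &, injective (fun j => h j (g j))}.
  by exists g => // x y; apply: ginj; rewrite mem_enum.
have: uniq (enum J) && (size (enum J) <= #|J|) by rewrite enum_uniq cardE /=.
elim: (enum J) => [_|j s IHs /= /andP[/andP[js us] szs]].
  have pickA j : {v | v \in A j}.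
    apply: (@sigW _ (mem (A j))); apply/set0Pn; rewrite -card_gt0.
    apply: leq_trans (cardA j).
    by apply/card_gt0P; exists j.
  by exists (fun j => sval (pickA j)) => // j; exact: (svalP (pickA j)).
have [|g gA ginj] := IHs; first by rewrite us ltnW.
have [v vA vs] : exists2 v, v \in A j & h j v \notin [seq h y (g y) | y <- s].
  apply/exists_inP; rewrite -[X in is_true X]negbK negb_exists_in.
  apply/forall_inP => sub.
  have uA : uniq (map (h j) (enum (A j))).
    rewrite map_inj_in_uniq ?enum_uniq// => x y /[!mem_enum]; exact: hinj.
  have: size (map (h j) (enum (A j))) <= size [seq h y (g y) | y <- s].
    apply: uniq_leq_size uA _ => _ /mapP[v /[!mem_enum] vA ->].
    exact: negbNE (sub v vA).
  rewrite !size_map -cardE leqNgt => /negP; apply.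
  exact: leq_trans (cardA j).
exists (fun y => if y == j then v else g y) => [y|x y].
  by case: eqP => [->|].
rewrite !inE; case: eqP => [-> _|_ /= xs]; case: eqP => [->|_ /= ys] //=.
- by move=> E; case/negP: vs; rewrite E map_f.
- by move=> _ E; case/negP: vs; rewrite -E map_f.
- exact: ginj.
Qed.

(** * The Littlewood-Offord inequality *)

Lemma ltn_sum_pointwise (I : finType) (f g : I -> nat) (i0 : I) :
  (forall i, f i <= g i) -> f i0 < g i0 -> \sum_i f i < \sum_i g i.
Proof.
move=> lefg ltfg; rewrite (bigD1 i0)//= [ltnRHS](bigD1 i0)//= -addSn.
by apply: leq_add => //; apply: leq_sum.
Qed.

(* Erdős' form of the Littlewood-Offord inequality.  Every [v] lies in [2 ^ #|I|]
   of the cubes [\prod_i {u i, u i + 1}] (indices taken modulo [k.+2]); inside one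
   cube, ordering each pair by [a i] turns equal sums into an antichain. *)
Lemma sqr_card_sum_eq (I : finType) (k : nat) (a : I -> 'I_k.+2 -> nat) (w : nat) :
    (forall i, injective (a i)) ->
  #|[set v : {ffun I -> 'I_k.+2} | \sum_i a i (v i) == w]| ^ 2 * #|I| <=
    (k.+2 ^ #|I|) ^ 2.
Proof.
move=> ainj; set A := [set v | _].
pose shift (E : {set I}) (u : {ffun I -> 'I_k.+2}) : {ffun I -> 'I_k.+2} :=
  [ffun i => (u i + (i \in E)%:R)%R].
have shiftI E : injective (shift E).
  by move=> u v /ffunP uv; apply/ffunP => i; have := uv i; rewrite !ffunE => /addIr.
pose N u := \sum_E (shift E u \in A : nat).
have sumN : \sum_u N u = 2 ^ #|I| * #|A|.
  rewrite exchange_big /= (eq_bigr (fun=> #|A|)) => [|E _].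
    by rewrite sum_nat_const -cardsT -powersetT card_powerset cardsT.
  rewrite -sum1_card [RHS](reindex_inj (shiftI E)) /= [RHS]big_mkcond /=.
  by apply: eq_bigr => u _; case: (_ \in A).
have leN u : N u ^ 2 * #|I|.+1 <= 4 ^ #|I|.
  (* In [shift (flip S) u], coordinate [i] takes the option of larger [a i]-value exactly when
     [i \in S], so the sum strictly increases with [S]. *)
  pose flip (S : {set I}) := [set i | (i \in S) (+) (a i (u i + 1)%R < a i (u i))].
  have flipK : involutive flip.
    by move=> S; apply/setP => i; rewrite !inE addbK.
  have -> : N u = #|[set S | shift (flip S) u \in A]|.
    rewrite /N (reindex_inj (inv_inj flipK)) -sum1_card [RHS]big_mkcond /=.
    by apply: eq_bigr => S _; rewrite !inE; case: (_ == w).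
  apply: sqr_card_antichain => S S'; rewrite !inE => /eqP ES /eqP ES' subSS'.
  apply/eqP; rewrite eqEsubset subSS' /=; apply/subsetP => i0 i0S'.
  apply: contraTT isT => i0S.
  suff : \sum_i a i (shift (flip S) u i) < \sum_i a i (shift (flip S') u i).
    by rewrite ES ES' ltnn.
  have neq i : a i (u i + 1)%R != a i (u i).
    by rewrite (inj_eq (ainj i)) -subr_eq0 [(u i + 1)%R]addrC addrK oner_eq0.
  apply: (@ltn_sum_pointwise _ _ _ i0) => [i|]; rewrite !ffunE !inE.
    have := neq i; have := subsetP subSS' i.
    case: (i \in S) => [->//|_]; case: (i \in S') => //=.
    by case: (ltngtP (a i (u i + 1)%R)) => //= lt _; rewrite addr0 ltnW.
  have := neq i0; rewrite i0S' (negPf i0S) /=.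
  by case: (ltngtP (a i0 (u i0 + 1)%R)) => //= lt _; rewrite addr0.
(* By the double count [sumN], the fullest cube holds at least the average number of elements of
   [A]. *)
have [u0 maxN] := bigop.eq_bigmax N (ltac:(rewrite card_ffun card_ord expn_gt0 //)).
have : 2 ^ #|I| * #|A| <= k.+2 ^ #|I| * N u0.
  have -> : k.+2 ^ #|I| = #|{ffun I -> 'I_k.+2}| by rewrite card_ffun card_ord.
  rewrite -sumN -maxN -sum_nat_const.
  by apply: leq_sum => u _; apply: leq_bigmax.
rewrite -leq_sqr !expnMn => leA.
rewrite -(@leq_pmul2l ((2 ^ #|I|) ^ 2)) ?expn_gt0// mulnA.
apply: leq_trans (leq_mul leA (leqnn _)) _.
rewrite -mulnA mulnC leq_mul2r; apply/orP; right.
rewrite -expnM [#|I| * 2]mulnC expnM; apply: leq_trans (leN u0); exact: leq_mul.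
Qed.

(** * Construction of the color matrix *)

(** In [B] the entry at [i] is determined by the one at [i'], so overwriting it by an arbitrary
    value loses no information. *)
Lemma card_agree (I : finType) (k : nat) (a : I -> 'I_k -> nat) (i i' : I) :
    (forall i, injective (a i)) -> i != i' ->
  #|[set v : {ffun I -> 'I_k} | a i (v i) == a i' (v i')]| * k <=
    #|{ffun I -> 'I_k}|.
Proof.
move=> ainj neq_ii'; set B := [set v | _].
pose upd (vy : {ffun I -> 'I_k} * 'I_k) : {ffun I -> 'I_k} :=
  [ffun l => if l == i then vy.2 else vy.1 l].
have <- : #|setX B [set: 'I_k]| = #|B| * k by rewrite cardsX cardsT card_ord.
rewrite -(@card_in_imset _ _ upd) ?max_card// => -[v y] [v' y'].
rewrite !inE !andbT /= => /eqP Ev /eqP Ev' /ffunP E.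
have {}E l : (if l == i then y else v l) = (if l == i then y' else v' l).
  by have := E l; rewrite !ffunE.
have -> : y = y' by have := E i; rewrite eqxx.
congr (_, _); apply/ffunP => l; have := E l.
case: eqVneq => [-> _|//]; apply: (ainj i); rewrite Ev Ev'.
by have := E i'; rewrite eq_sym (negPf neq_ii') => ->.
Qed.

(* Union bound: uniformly random columns agree on two given rows in all the
   columns in which both are not free with probability at most [2 ^ (2 - t)]. *)
Lemma separating_columns (I : finType) (k t : nat)
    (a : 'I_t -> I -> 'I_k.+2 -> nat) (free : 'I_t -> pred I) :
    (forall s i, injective (a s i)) ->
    (forall i, #|[set s | free s i]| <= 1) -> #|I| ^ 2 < 2 ^ (t - 2) ->
  exists x : 'I_t -> {ffun I -> 'I_k.+2}, forall i i', i != i' ->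
    exists s, [/\ ~~ free s i, ~~ free s i' & a s i (x s i) != a s i' (x s i')].
Proof.
move=> ainj free1 ltI; pose V := {ffun I -> 'I_k.+2}.
pose B (p : I * I) (s : 'I_t) : {set V} :=
  if free s p.1 || free s p.2 then setT
  else [set v : V | a s p.1 (v p.1) == a s p.2 (v p.2)].
pose bad p := [set x : {ffun 'I_t -> V} | [forall s, x s \in B p s]].
have card_bad p : p.1 != p.2 -> #|bad p| * 2 ^ (t - 2) <= #|{ffun 'I_t -> V}|.
  move=> neqp.
  have -> : #|bad p| = \prod_s #|B p s|.
    rewrite -(big_enum _ _ _ (fun s => #|B p s|)) /=.
    rewrite -(big_map (fun s => #|B p s|) xpredT id) -foldrE.
    rewrite -(card_family (fun s => mem (B p s))); apply: eq_card => x.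
    by rewrite inE; apply/forallP/familyP.
  have -> : #|{ffun 'I_t -> V}| = \prod_(s < t) #|V|.
    by rewrite card_ffun card_ord prod_nat_const card_ord.
  pose F := [set s | free s p.1] :|: [set s | free s p.2].
  (* Each of the two rows is free in at most one column, so at least [t - 2] columns each save a
     factor of at least 2. *)
  apply: (@leq_trans (\prod_s #|B p s| * 2 ^ #|~: F|)).
    rewrite leq_mul2l leq_exp2l// cardsCs setCK card_ord; apply/orP; right.
    apply: leq_sub2l; apply: leq_trans (leq_card_setU _ _).1 _.
    by rewrite -[2]/(1 + 1); apply: leq_add; apply: free1.
  rewrite -prod_nat_const [X in _ * X <= _]big_mkcond /= -big_split /=.
  apply: leq_prod => s _; rewrite /B !inE; case: ifP => [_|_] /=.
    by rewrite muln1 max_card.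
  by apply: leq_trans (card_agree (ainj s) neqp); apply: leq_mul.
have [x /forallP xP] : exists x : {ffun 'I_t -> V},
    [forall p, (p.1 != p.2) ==> (x \notin bad p)].
  apply/existsP; apply: contraLR ltI => /existsPn allbad; rewrite -leqNgt.
  have X_gt0 : 0 < #|{ffun 'I_t -> V}|.
    by rewrite card_ffun expn_gt0 card_ffun card_ord expn_gt0.
  rewrite -(leq_pmul2l X_gt0) -mulnn -card_prod.
  have leX : #|{ffun 'I_t -> V}| <= \sum_(p | p.1 != p.2) #|bad p|.
    rewrite -sum1_card; under [leqRHS]eq_bigr do rewrite -sum1_card big_mkcond.
    rewrite exchange_big; apply: leq_sum => x _.
    have := allbad x; rewrite negb_forall => /existsP[p].
    by rewrite negb_imply negbK => /andP[neqp xp]; rewrite (bigD1 p)//= xp.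
  apply: leq_trans (leq_mul leX (leqnn _)) _; rewrite big_distrl /= mulnC.
  rewrite -sum_nat_const [leqRHS](bigID (fun p : I * I => p.1 != p.2)) /=.
  by apply: leq_trans (leq_addr _ _); apply: leq_sum => p; apply: card_bad.
exists x => i i' neq_ii'; have := xP (i, i'); rewrite /= neq_ii' inE.
rewrite negb_forall => /existsP[s xs]; exists s.
by move: xs; rewrite /B /=; case: ifP => [_|/negbT/norP[? ?]]; rewrite inE.
Qed.

(* The entries in the free rows of a column do not affect the separation of
   rows; switching them one by one from [lo] to [hi] yields [t] distinct sums, so
   that the sums of the [t] columns can be made pairwise distinct greedily. *)
Lemma separating_columns_sum_inj (n k t : nat)
    (a : 'I_t -> 'I_n -> 'I_k.+2 -> nat) :
    (forall s i, injective (a s i)) -> t * t <= n -> n ^ 2 < 2 ^ (t - 2) ->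
  exists2 x : 'I_t -> {ffun 'I_n -> 'I_k.+2},
    injective (fun s => \sum_i a s i (x s i)) &
    forall i i', (forall s, a s i (x s i) = a s i' (x s i')) -> i = i'.
Proof.
(* Column [s] is free on the block of rows from [s * t] to [s * t + t - 1]. The blocks are disjoint,
   and all fit because [t * t <= n]. *)
move=> ainj le_tn lt_n2; pose free (s : 'I_t) (i : 'I_n) := i %/ t == s.
have free1 i : #|[set s | free s i]| <= 1.
  apply/card_le1_eqP => s s'; rewrite !inE => /eqP Es /eqP Es'.
  by apply: val_inj; rewrite /= -Es -Es'.
have [|x xP] := separating_columns ainj free1; first by rewrite card_ord.
pose lo s i : 'I_k.+2 := if a s i ord0 < a s i ord_max then ord0 else ord_max.
pose hi s i : 'I_k.+2 := if a s i ord0 < a s i ord_max then ord_max else ord0.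
have lohi s i : a s i (lo s i) < a s i (hi s i).
  rewrite /lo /hi; case: (ltngtP (a s i ord0)) => // /ainj/eqP.
  by rewrite -val_eqE.
pose y s (r : 'I_t) := [ffun i : 'I_n => if free s i then
  if i %% t < r then hi s i else lo s i else x s i].
pose opt s r := \sum_i a s i (y s r i).
have lt_opt s (r r' : 'I_t) : r < r' -> opt s r < opt s r'.
  move=> lt_rr'; have t_gt0 : 0 < t by apply: leq_ltn_trans (ltn_ord r).
  (* This row of the block is still [lo] for [r] but already [hi] for [r']. *)
  have lt_in : s * t + r < n.
    apply: leq_trans le_tn; apply: (@leq_trans (s.+1 * t)).
      by rewrite mulSnr ltn_add2l.
    by rewrite leq_mul2r ltn_ord orbT.
  apply: (@ltn_sum_pointwise _ _ _ (Ordinal lt_in)) => [i|]; rewrite !ffunE.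
    case: ifP => // _; case: ifP => [lt_ir|_]; first by rewrite (ltn_trans lt_ir).
    by case: ifP => // _; apply: ltnW.
  rewrite /free /= divnMDl// divn_small// addn0 eqxx modnMDl modn_small//.
  by rewrite ltnn lt_rr'.
have opt_inj s : injective (opt s).
  move=> r r' E; apply: val_inj; case: (ltngtP r r') => // /(lt_opt s);
  by rewrite E ltnn.
have [|s|g _ ginj] := @greedy_transversal _ _ _ opt (fun=> setT).
- by move=> s r r' _ _; apply: opt_inj.
- by rewrite cardsT.
exists (fun s => y s (g s)) => // i i' E; apply/eqP; apply: contraT => /xP[s].
by case=> /negPf fi /negPf fi'; have := E s; rewrite !ffunE fi fi' => -> /eqP.
Qed.

(* The first [t] columns fix the rows, and are recognised by their sums, which
   no other column attains. *)
Lemma asymmetric_matrix (n m k t : nat) (a : 'I_n -> 'I_m -> 'I_k.+2 -> nat) :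
    (forall i j, injective (a i j)) ->
    t <= m -> t * t <= n -> n ^ 2 < 2 ^ (t - 2) ->
    (forall M, M ^ 2 * n <= (k.+2 ^ n) ^ 2 -> m + t * M <= k.+2 ^ n) ->
  exists x : 'I_n -> 'I_m -> 'I_k.+2, let c i j := a i j (x i j) in
    [/\ forall j j' : 'I_m, j < t -> \sum_i c i j = \sum_i c i j' -> j = j',
        forall i i', (forall j : 'I_m, j < t -> c i j = c i' j) -> i = i'
      & forall j j', (forall i, c i j = c i j') -> j = j'].
Proof.
move=> ainj le_tm le_tn lt_n2 le_mk; pose V := {ffun 'I_n -> 'I_k.+2}.
pose w := widen_ord le_tm.
have [x x_inj x_sep] := separating_columns_sum_inj
  (fun s i => ainj i (w s)) le_tn lt_n2.
pose ty s := \sum_i a i (w s) (x s i).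
pose A (j : 'I_m) := [set v : V | [forall s, \sum_i a i j (v i) != ty s]].
pose h (j : 'I_m) (v : V) := [ffun i => a i j (v i)].
have hinj j : injective (h j).
  move=> v v' /ffunP E; apply/ffunP => i; apply: (ainj i j).
  by have := E i; rewrite !ffunE.
have cardA j : m <= #|A j|.
  pose B s := [set v : V | \sum_i a i j (v i) == ty s].
  have : k.+2 ^ n <= #|A j| + t * \max_s #|B s|.
    have -> : k.+2 ^ n = #|V| by rewrite card_ffun !card_ord.
    rewrite -cardsT -(setUCr (A j)); apply: leq_trans (leq_card_setU _ _).1 _.
    rewrite leq_add2l.
    have : ~: A j \subset \bigcup_s B s.
      apply/subsetP => v; rewrite !inE negb_forall => /existsP[s].
      by rewrite negbK => vs; apply/bigcupP; exists s; rewrite ?inE.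
    move=> /subset_leq_card/leq_trans; apply.
    apply: (@leq_trans (\sum_s #|B s|)).
      elim/big_rec2: _ => [|s p q _ le_pq]; first by rewrite cards0.
      by apply: leq_trans (leq_card_setU _ _).1 _; rewrite leq_add2l.
    apply: (@leq_trans (\sum_(s < t) \max_s #|B s|)).
      by apply: leq_sum => s _; apply: leq_bigmax.
    by rewrite sum_nat_const card_ord.
  have [t0|t_gt0] := posnP t.
    rewrite {1}t0 mul0n addn0; apply: leq_trans; apply: leq_trans (le_mk 0 _).
      exact: leq_addr.
    by rewrite mul0n.
  have [s ->] := @bigop.eq_bigmax _ (fun s => #|B s|) (ltac:(by rewrite card_ord)).
  have := le_mk #|B s|.
  have := @sqr_card_sum_eq _ _ (fun i => a i j) (ty s) (fun i => ainj i j).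
  rewrite card_ord => leB /(_ leB) le1 le2.
  by rewrite -(leq_add2r (t * #|B s|)); apply: leq_trans le1 le2.
have [j|j|g gA ginj] := @greedy_transversal _ _ _ h A.
- exact: in2W (hinj j).
- by rewrite card_ord.
(* The greedy choice [g] was made for all columns; its first [t] values are discarded in favor of
   [x]. *)
pose col (j : 'I_m) : V := if insub (j : nat) is Some s then x s else g j.
have col_lt s : col (w s) = x s.
  by rewrite /col; case: insubP => [s' _ /val_inj -> //|/negP[]]; apply: (ltn_ord s).
have col_ge (j : 'I_m) : t <= j -> col j = g j.
  by rewrite leqNgt /col; case: insubP => // s ->.
have wP (j : 'I_m) : j < t -> exists s, j = w s.
  by move=> lt_jt; exists (Ordinal lt_jt); apply: val_inj.
have types (j j' : 'I_m) : j < t ->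
    \sum_i a i j (col j i) = \sum_i a i j' (col j' i) -> j = j'.
  move=> /wP[s ->]; have [/wP[s' ->]|/col_ge ->] := ltnP j' t.
    by rewrite !col_lt => /x_inj ->.
  rewrite col_lt => E; have := gA j'; rewrite inE => /forallP/(_ s).
  by rewrite -E eqxx.
exists (fun i j => col j i); split=> // [i i' E|j j' E].
  by apply: x_sep => s; have := E (w s) (ltn_ord s); rewrite !col_lt.
have Es : \sum_i a i j (col j i) = \sum_i a i j' (col j' i) by apply: eq_bigr.
have [lt_jt|ge_jt] := ltnP j t; first exact: types Es.
have [lt_jt|ge_jt'] := ltnP j' t; first by apply/esym/types.
apply: ginj; apply/ffunP => i; have := E i.
by rewrite !ffunE (col_ge j ge_jt) (col_ge j' ge_jt').
Qed.

(** * Automorphisms and list colorings of the product *)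

Lemma list_dist_number_min (G : sgraph) (k : nat) :
  list_distinguishable G k -> list_dist_number G <= k.
Proof.
by rewrite /list_dist_number; case: ex_minnP => l _ + Gk; apply; apply/asboolP.
Qed.

(* The closed neighbourhoods of two vertices of a row intersect in that row, and
   those of two vertices of a column in that column: as [n <> m], automorphisms
   map rows to rows and columns to columns. *)
Lemma cart_prod_complete_aut (n m : nat)
    (s : {perm cart_prod (complete_graph n) (complete_graph m)}) :
    n != m -> is_automorphism s ->
  forall x y, ((s x).1 == (s y).1) = (x.1 == y.1) /\
              ((s x).2 == (s y).2) = (x.2 == y.2).
Proof.
move=> neq_nm s_aut.
pose near (x y : 'I_n * 'I_m) := (x.1 == y.1) || (x.2 == y.2).
have nearE x y : near x y =
    (x == y) || @adj (cart_prod (complete_graph n) (complete_graph m)) x y.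
  case: x y => [i j] [i' j']; rewrite /near /adj /= /cart_adj /=.
  rewrite /complete_adj xpair_eqE.
  by case: (i == i'); case: (j == j').
have near_s x y : near (s x) (s y) = near x y.
  by rewrite !nearE s_aut (inj_eq perm_inj).
pose N x y := #|[set z | near x z && near y z]|.
have N_s x y : N (s x) (s y) = N x y.
  rewrite /N -[RHS](card_imset _ (@perm_inj _ s)); apply: eq_card => z.
  rewrite inE -[z](permKV s) mem_imset ?inE ?near_s//; exact: perm_inj.
have N_row (x y : 'I_n * 'I_m) : x != y -> x.1 = y.1 -> N x y = m.
  case: x y => [i j] [i' j'] /= + Ei; rewrite Ei xpair_eqE eqxx /= => neq_j.
  rewrite -[RHS]mul1n -[1](cards1 i') -[X in _ * X]card_ord -cardsT -cardsX.
  apply: eq_card => -[k l]; rewrite !inE andbT /near /= (eq_sym k).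
  by case: eqP => //= _; apply: contraNF neq_j => /andP[/eqP -> /eqP ->]; rewrite eqxx.
have N_col (x y : 'I_n * 'I_m) : x != y -> x.2 = y.2 -> N x y = n.
  case: x y => [i j] [i' j'] /= + Ej; rewrite Ej xpair_eqE eqxx andbT /= => neq_i.
  rewrite -[RHS]muln1 -[1](cards1 j') -[X in X * _]card_ord -cardsT -cardsX.
  apply: eq_card => -[k l]; rewrite !inE /= /near /= !(eq_sym j').
  case: (l =P j') => _; rewrite ?(orbT, andbT) // !orbF.
  by apply: contraNF neq_i => /andP[/eqP -> /eqP ->]; rewrite eqxx.
move=> x y; have [->|neq_xy] := eqVneq x y; first by rewrite !eqxx.
have neq_s : s x != s y by rewrite (inj_eq perm_inj).
have := near_s x y; have := N_s x y; rewrite /near.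
have both u v : u != v :> 'I_n * 'I_m -> (u.1 == v.1) && (u.2 == v.2) = false.
  by move=> /negPf uv; rewrite -xpair_eqE -!surjective_pairing.
have := both _ _ neq_xy; have := both _ _ neq_s.
have := N_row _ _ neq_xy; have := N_col _ _ neq_xy.
have := N_row _ _ neq_s; have := N_col _ _ neq_s.
move: neq_nm.
(* Simplification leaves only the two cases where [s] exchanges a row pair with a column pair;
   counting common closed neighbors then gives [n = m]. *)
case: ((s x).1 =P (s y).1) => [E1|_]; case: ((s x).2 =P (s y).2) => [E2|_];
 case: (x.1 =P y.1) => [F1|_]; case: (x.2 =P y.2) => [F2|_] //= /eqP neq_nm.
- by move=> _ /(_ E1) -> /(_ F2) -> _ _ _ E; case: neq_nm.
- by move=> /(_ E2) -> _ _ /(_ F1) -> _ _ E; case: neq_nm.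
Qed.

Lemma card_le_ord_inj (C : Type) (L : set C) (k : nat) :
  (`I_k #<= L)%card -> exists2 f : 'I_k -> C, injective f & forall u, L (f u).
Proof.
move=> /card_leP[f].
pose e (u : 'I_k) : `I_k := SigSub (mem_set (ltn_ord u : `I_k u)).
exists (fun u => set_val (f (e u))) => [u v|u]; last exact/set_mem/valP.
move=> /val_inj feq; have Euv : e u = e v by exact: injT feq.
exact: ord_inj (congr1 set_val Euv).
Qed.

(** This makes column sums meaningful for colors of an arbitrary type: only the finitely many values
    of [f] need codes, namely their positions in [codom f]. *)
Lemma nat_code (T : finType) (C : Type) (f : T -> C) :
  exists num : C -> nat, forall x y, num (f x) = num (f y) -> f x = f y.
Proof.
suff code (D : eqType) (g : T -> D) :
    exists num : D -> nat, forall x y, num (g x) = num (g y) -> g x = g y.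
  exact: (code {classic C} f).
exists (index^~ (codom g)) => x y.
by apply: (@index_inj _ (g x)); apply: codom_f.
Qed.

Lemma cart_prod_complete_list_distinguishable (n m k t : nat) :
    0 < n < m -> t <= m -> t * t <= n -> n ^ 2 < 2 ^ (t - 2) ->
    (forall M, M ^ 2 * n <= (k.+2 ^ n) ^ 2 -> m + t * M <= k.+2 ^ n) ->
  list_distinguishable (cart_prod (complete_graph n) (complete_graph m)) k.+2.
Proof.
move=> /andP[n_gt0 lt_nm] le_tm le_tn lt_n2 le_mk C L sizeL.
have m_gt0 : 0 < m := ltn_trans n_gt0 lt_nm.
have /choice[l lP] : forall v : 'I_n * 'I_m, exists f : 'I_k.+2 -> C,
    injective f /\ forall u, L v (f u).
  by move=> v; have [f finj Lf] := card_le_ord_inj (sizeL v); exists f.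
have [num num_inj] := nat_code (fun p : ('I_n * 'I_m) * 'I_k.+2 => l p.1 p.2).
pose a i j u := num (l (i, j) u).
have ainj i j : injective (a i j) by move=> u u' /(num_inj (_, u) (_, u'))/(lP _).1.
have [x [c_type c_row c_col]] := asymmetric_matrix ainj le_tm le_tn lt_n2 le_mk.
exists (fun v => l v (x v.1 v.2)); split=> [v|s s_aut s_col]; first exact: (lP v).2.
have neq_nm : n != m by rewrite neq_ltn lt_nm.
have s_eq := cart_prod_complete_aut neq_nm s_aut.
pose sg (i : 'I_n) : 'I_n := (s (i, Ordinal m_gt0)).1.
pose tau (j : 'I_m) : 'I_m := (s (Ordinal n_gt0, j)).2.
have sE i j : s (i, j) = (sg i, tau j).
  rewrite [LHS]surjective_pairing; congr (_, _); apply/eqP.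
    by rewrite (s_eq _ _).1.
  by rewrite (s_eq _ _).2.
have sg_inj : injective sg.
  by move=> i i' /eqP; rewrite (s_eq _ _).1 => /eqP.
have cE i j : a (sg i) (tau j) (x (sg i) (tau j)) = a i j (x i j).
  by rewrite /a -sE; have := s_col (i, j); rewrite sE => ->.
have tau_id (j : 'I_m) : j < t -> tau j = j.
  (* By [cE], column [tau j] is column [j] with its entries permuted by [sg], so both have the same
     sum. *)
  move=> lt_jt; apply/esym/c_type => //; rewrite [RHS](reindex_inj sg_inj).
  by apply: eq_bigr => i _.
have sg_id i : sg i = i.
  by apply: c_row => j /tau_id tau_j; rewrite -[RHS]cE tau_j.
apply/permP => -[i j]; rewrite perm1 sE sg_id; congr (_, _).
by apply: c_col => i'; rewrite -[RHS]cE sg_id.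
Qed.

(** * Numerical estimates and conclusion *)

Lemma list_dist_number_card (G : sgraph) : list_dist_number G <= #|G|.
Proof. exact/list_dist_number_min/list_distinguishable_card. Qed.

(** This rests on [1.09 ^ 8 <= 2]; the factor 8 is the one that absorbs the [t] reserved sums in the
    final count. *)
Lemma log109_ge (R : realType) (n q : nat) : 2 ^ q <= n ->
  ((8 * q)%:R <= ln n%:R / ln (109%:R / 100%:R) :> R)%R.
Proof.
move=> le_qn; have b_gt1 : (1 < 109%:R / 100%:R :> R)%R by lra.
have ln_gt0 : (0 < ln (109%:R / 100%:R : R))%R by exact: ln_gt0.
have b_gt0 : (0 < 109%:R / 100%:R :> R)%R by lra.
have b8 : ((109%:R / 100%:R : R) ^+ 8 <= 2%:R)%R.
  by rewrite !exprS expr0; lra.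
rewrite ler_pdivlMr// [(_ * ln _)%R]mulr_natl -lnXn// ler_ln
  ?posrE ?exprn_gt0//; last first.
  by rewrite ltr0n; apply: leq_trans le_qn; rewrite expn_gt0.
apply: (@le_trans _ _ ((2 ^ q)%:R)%R); last by rewrite ler_nat.
by rewrite exprM natrX lerXn2r// nnegrE ?exprn_ge0 ?ltW// ler0n.
Qed.

Theorem theorem2 (R : realType) (n m k : nat) :
  (0 < n)%N -> (0 < m)%N -> (0 < k)%N ->
  (n < m)%N ->
  (m%:R <= k%:R ^+ n *
     (1 - (ln n%:R / ln (109%:R / 100%:R)) / Num.sqrt (2%:R * n%:R)) :> R)%R ->
  (list_dist_number (cart_prod (complete_graph n) (complete_graph m)) <= k)%N.
Proof.
move=> n_gt0 m_gt0 k_gt0 lt_nm le_m.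
have [n1|n_neq1] := eqVneq n 1.
  (* For [n = 1] the logarithm vanishes and the hypothesis reads [m <= k], so all vertices can get
     distinct colors. *)
  move: le_m; rewrite n1 ln1 !mul0r subr0 mulr1 expr1 ler_nat; apply: leq_trans.
  apply: leq_trans (list_dist_number_card _) _.
  by rewrite card_prod !card_ord mul1n.
(* This [t] gives [2 ^ (t - 2) = (2 ^ q.+1) ^ 2 > n ^ 2]. *)
pose q := trunc_log 2 n; pose t := 2 * q + 4.
have /andP[le_qn lt_nq] : 2 ^ q <= n < 2 ^ q.+1 by exact: trunc_log_bounds.
have q_gt0 : 0 < q by rewrite trunc_log_gt0; lia.
have := log109_ge R le_qn; move: le_m; set lg := (ln _ / _)%R.
set S := Num.sqrt _; rewrite -natrX; set K := k ^ n => le_m le_lg.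
have S_gt0 : (0 < S)%R by rewrite sqrtr_gt0 mulr_gt0 ?ltr0n.
have SS : (S ^+ 2 = (2 * n)%:R)%R by rewrite sqr_sqrtr ?mulr_ge0 ?ler0n// natrM.
have K_gt0 : 0 < K by rewrite expn_gt0 k_gt0.
have le_mS : (m%:R * S <= K%:R * (S - lg))%R.
  rewrite (_ : K%:R * (S - lg) = K%:R * (1 - lg / S) * S)%R ?ler_pM2r//.
  by rewrite -mulrA; congr (_ * _)%R; rewrite mulrBl mul1r divfK// gt_eqF.
have lt_lgS : (lg < S)%R.
  rewrite -subr_gt0 -(@pmulr_rgt0 _ K%:R%R) ?ltr0n//.
  by apply: lt_le_trans le_mS; rewrite mulr_gt0 ?ltr0n.
(* Since [m > 0], the hypothesis itself forces [n] to be large: [8 * q <= lg < S] gives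
   [(8 * q) ^ 2 < 2 * n < 4 * 2 ^ q]. *)
have lt_q2 : 16 * q ^ 2 < 2 ^ q.
  suff : (8 * q) ^ 2 < 2 * n by rewrite expnS in lt_nq *; nia.
  rewrite -(ltr_nat R) natrX -SS ltrXn2r ?ler0n ?(ltW S_gt0)//.
  exact: le_lt_trans le_lg lt_lgS.
have le_tq : t <= 4 * q.
  suff : q != 1 by rewrite /t; lia.
  by apply: contraTneq lt_q2 => ->.
have le_tn : t * t <= n.
  apply: leq_trans le_qn; apply: ltnW; apply: leq_ltn_trans lt_q2; nia.
have k_gt1 : 1 < k.
  rewrite ltn_neqAle k_gt0 andbT eq_sym; apply/eqP => k1.
  have : m <= K.
    rewrite -(ler_nat R); apply: le_trans le_m _.
    rewrite ler_piMr ?ler0n// lerBlDr lerDl.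
    by rewrite divr_ge0 ?(ltW S_gt0)// (le_trans _ le_lg).
  by rewrite /K k1 exp1n; lia.
apply: list_dist_number_min; case: k => [|[|k']] // in k_gt0 k_gt1 K K_gt0 le_m le_mS *.
apply: (@cart_prod_complete_list_distinguishable _ _ _ t) => //.
- by rewrite n_gt0.
- by nia.
- apply: (@leq_trans ((2 ^ q.+1) ^ 2)); first by rewrite ltn_sqr.
  by rewrite -expnM leq_exp2l//; lia.
(* After multiplication by [S], the reserved sums cost [t * M * S <= 4 * q * (2 * K) <= lg * K],
   exactly the amount by which [K * (S - lg)] falls short of [K * S]. *)
move=> M leM; rewrite -/K -(ler_nat R) -(ler_pM2r S_gt0).
have leMS : (M%:R * S <= 2%:R * K%:R)%R.
  rewrite -(@ler_pXn2r _ 2) ?nnegrE ?mulr_ge0 ?ler0n ?(ltW S_gt0)// !exprMn SS.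
  by rewrite -!natrX -!natrM ler_nat; nia.
have : (t%:R * (M%:R * S) <= (4 * q)%:R * (2%:R * K%:R))%R.
  by rewrite ler_pM ?mulr_ge0 ?ler0n ?ler_nat// (ltW S_gt0).
have : ((8 * q)%:R * K%:R <= lg * K%:R)%R by rewrite ler_wpM2r.
rewrite natrD !natrM; move: le_mS; clear; lra.
Qed.
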